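(* Let $k$ be a field of characteristic $p$ ($p=0$ or $p$ prime), $G$ a finite group, and $X,Y$ faithful $G$-sets with $\#X=\#Y=n$. Choose bijections $X\to\{1,\ldots,n\}$ and $Y\to\{1,\ldots,n\}$, let $\varphi_X,\varphi_Y:G\to S_n$ be the resulting action homomorphisms, and let $X'=S_n/\varphi_X(G)$ and $Y'=S_n/\varphi_Y(G)$. If $k[X']\cong k[Y']$ as $kS_n$-modules, then for any cyclic mod $p$ subgroup $H_1\subset G$ there exists a subgroup $H_2\subset G$ such that the restriction of $X$ to $H_1$ and the restriction of $Y$ to $H_2$ are similar. In particular, $\#\mathrm{Fix}_X(H_1)=\#\mathrm{Fix}_Y(H_2)$.
   Context: For a $\Gamma$-set $Z$, $k[Z]$ denotes the permutation module of maps $Z\to k$ over the group algebra $k\Gamma$, and $\mathrm{Fix}_Z(\Gamma)$ is the set of points of $Z$ fixed by every element of $\Gamma$. An $H_1$-set $Z$ and an $H_2$-set $W$ are similar if there are a bijection $\mu:Z\to W$ and a group isomorphism $\psi:H_1\to H_2$ with $\mu(h z)=\psi(h)\mu(z)$ for all $h\in H_1$, $z\in Z$. For $p$ prime, a finite group is called cyclic mod $p$ if it has a normal $p$-subgroup with cyclic quotient; ''cyclic mod $0$'' means cyclic. *)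

(* Defs.v *)
From HB Require Import structures.
From mathcomp Require Import all_boot all_order all_algebra all_fingroup.
From mathcomp Require Import all_solvable.

Set Implicit Arguments.
Unset Strict Implicit.
Unset Printing Implicit Defensive.

Import GRing.Theory.
Local Open Scope group_scope.

(* Actions are right actions throughout, as in action.v: a left Gamma-set Z is
   the same thing as a right one through g z = to z g^-1.  Likewise a product
   s * t in 'S_n is "s first, then t". *)

(* Characteristic p of k, where p = 0 is allowed. *)
Definition has_char (k : fieldType) (p : nat) : Prop :=
  (if p == 0%N then [pchar k] =i pred0 else p \in [pchar k])%R.

Definition cyclic_mod (p : nat) (gT : finGroupType) (H : {group gT}) : bool :=
  if p == 0%N then cyclic H
  else [exists P : {group gT}, [&& P <| H, p.-group P & cyclic (H / P)]].

Definition similar_gsets (aT1 aT2 : finGroupType) (H1 : {group aT1})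
    (H2 : {group aT2}) (Z W : finType)
    (toZ : action H1 Z) (toW : action H2 W) : Prop :=
  exists (mu : Z -> W) (psi : {morphism H1 >-> aT2}),
    [/\ bijective mu, isom H1 H2 psi
      & forall h, h \in H1 -> forall z, mu (toZ z h) = toW (mu z) (psi h)].

Section PermutationModule.
Variables (k : fieldType) (aT : finGroupType).

(* The left k[aT]-module k[Z] of maps Z -> k, given by its k-vector space
   {ffun Z -> k^o} and the operators below.  With the left action
   g z = to z g^-1 this is the usual (g f)(z) = f (g^-1 z). *)
Definition permmod_act (Z : finType) (to : {action aT &-> Z}) (g : aT)
    (f : {ffun Z -> k^o}) : {ffun Z -> k^o} := [ffun z => f (to z g)].

Lemma permmod_act_linear (Z : finType) (to : {action aT &-> Z}) g :
  linear (permmod_act to g).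
Proof. by move=> a u v; apply/ffunP=> z; rewrite !ffunE. Qed.

HB.instance Definition _ (Z : finType) (to : {action aT &-> Z}) g :=
  GRing.isLinear.Build k {ffun Z -> k^o} {ffun Z -> k^o} *:%R
    (permmod_act to g) (permmod_act_linear to g).

Lemma permmod_act1 (Z : finType) (to : {action aT &-> Z}) f :
  permmod_act to 1 f = f.
Proof. by apply/ffunP=> z; rewrite ffunE act1. Qed.

Lemma permmod_actM (Z : finType) (to : {action aT &-> Z}) g h f :
  permmod_act to (g * h) f = permmod_act to g (permmod_act to h f).
Proof. by apply/ffunP=> z; rewrite !ffunE actM. Qed.

(* A k[aT]-linear map is a k-linear map commuting with the elements of aT. *)
Definition permmod_iso (Z W : finType)
    (toZ : {action aT &-> Z}) (toW : {action aT &-> W}) : Prop :=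
  exists phi : {linear {ffun Z -> k^o} -> {ffun W -> k^o}}%R,
    bijective phi /\
    forall g f, phi (permmod_act toZ g f) = permmod_act toW g (phi f).

End PermutationModule.

Section CosetSpace.
Variables (gT : finGroupType) (H : {group gT}).

(* Right cosets, for the right multiplication action.  For gT = 'S_n these are
   the left cosets of H for the product s \o t of functions. *)
Definition coset_space : finType :=
  {A : {set gT} | A \in rcosets H [set: gT]}.

Lemma coset_space_dom :
  [set: gT] \subset subact_dom [in rcosets H [set: gT]] 'Rs.
Proof.
rewrite /subact_dom; have := actsRs_rcosets H [set: gT].
by congr (_ \subset 'N(_ | _)); apply/setP=> A; rewrite inE.
Qed.

Definition coset_action : {action gT &-> coset_space} :=
  ([action of subact (sT := {A | A \in rcosets H [set: gT]}) 'Rs]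
     \ coset_space_dom)%act.

Lemma val_coset_action (A : coset_space) g :
  val (coset_action A g) = val A :* g.
Proof.
rewrite /= /ract /= val_subact.
by rewrite (subsetP coset_space_dom) ?inE //= rcosetE.
Qed.

End CosetSpace.

Section ActionHom.
Variables (gT : finGroupType) (X : finType) (to : {action gT &-> X}) (n : nat).
Variables (e : X -> 'I_n) (e' : 'I_n -> X).
Hypotheses (eK : cancel e e') (e'K : cancel e' e).

Lemma action_hom_inj g : injective (fun i => e (to (e' i) g)).
Proof. by move=> i j /(can_inj eK)/act_inj/(can_inj e'K). Qed.

(* e' is the inverse of the labelling e. *)
Definition action_hom (g : gT) : 'S_n := perm (@action_hom_inj g).

Lemma action_homM : {in [set: gT] &, {morph action_hom : g h / g * h}}.
Proof. by move=> g h _ _; apply/permP=> i; rewrite permM !permE eK actM. Qed.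

Canonical action_hom_morphism := Morphism action_homM.

Definition action_image : {group 'S_n} := action_hom @* [set: gT].

End ActionHom.

(* Main.v *)
(** Write [H1 = P <g>] with [P] a normal [p]-subgroup.  A [P]-invariant function
on [Z] supported off [Z^P] evaluates, after any equivariant linear map
[k[Z] -> k[W]], to [0] on [W^P]: each nontrivial [P]-orbit contributes a multiple
of its length, which vanishes in [k].  Hence an isomorphism [k[Z] = k[W]] induces
one between the [C]-invariant functions on [Z^P] and on [W^P], for every
[C <= N(P)] (a hands-on form of the Brauer quotient), so [Z^P] and [W^P] have
equally many [C]-orbits.  For [C] running over the subgroups of [<g>],
Cauchy-Frobenius counting and induction on the order give
[|Z^(P<g>)| = |W^(P<g>)|].  On cosets of the images of [G] in [S_n], this says
that [H1], which fixes the trivial coset of [X'], is conjugate in [S_n] to a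
subgroup of the image of [G] acting on [Y]; the conjugating permutation is the
required similarity. *)

From HB Require Import structures.
Require Import Defs.
From mathcomp Require Import all_boot all_order all_algebra all_fingroup.
From mathcomp Require Import all_solvable.

Set Implicit Arguments.
Unset Strict Implicit.
Unset Printing Implicit Defensive.

Import GRing.Theory.
Local Open Scope group_scope.

(** * Orbit lengths in [k] and the structure of cyclic mod [p] groups *)

(** Non-fixed points have proper stabilisers in [P], so this makes the length of every nontrivial
    [P]-orbit zero in [k]. *)
Definition index_vanishing (k : fieldType) (aT : finGroupType)
    (P : {group aT}) : Prop :=
  forall Q : {group aT}, Q \proper P -> (#|P : Q|%:R = 0 :> k)%R.

(* If [p = 0], a [p]-group is trivial, so characteristic zero needs no separate
   treatment. *)
Lemma pgroup_index_vanishing (k : fieldType) (aT : finGroupType) (p : nat)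
    (P : {group aT}) :
  has_char k p -> p.-group P -> index_vanishing k P.
Proof.
move=> chark pP Q /andP[sQP nsPQ].
have /p_natP[[|e] def_i]: p.-nat #|P : Q|.
- by apply: pnat_dvd pP; apply: dvdn_indexg.
- by rewrite (index1g sQP def_i) subxx in nsPQ.
move: chark; rewrite /has_char; case: eqP => [p0 | _ chark].
  by have := indexg_gt0 P Q; rewrite def_i p0 exp0n.
by apply/eqP; rewrite -(dvdn_pcharf chark) def_i expnS dvdn_mulr.
Qed.

(** A generator of the cyclic quotient lifts to [g]. For [p = 0] the trivial [P] gives the same
    form. *)
Lemma cyclic_mod_gen (p : nat) (aT : finGroupType) (H : {group aT}) :
    cyclic_mod p H ->
  exists (P : {group aT}) (g : aT),
    [/\ p.-group P, g \in 'N(P) & H :=: P * <[g]>].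
Proof.
rewrite /cyclic_mod; case: eqP => [_ /cyclicP[g defH] | _].
  by exists 1%G, g; rewrite pgroup1 norm1 inE mul1g.
case/existsP=> P /and3P[nsPH pP /cyclicP[cg defHP]].
have: cg \in H / P by rewrite defHP cycle_id.
case/morphimP=> g nPg Hg def_cg; exists P, g; split=> //.
have sPH := normal_sub nsPH.
apply/eqP; rewrite eqEsubset mul_subG ?cycle_subG // andbT.
rewrite -quotientSK ?normal_norm // defHP def_cg.
by rewrite quotient_cycle.
Qed.

Lemma sum_fix_vanish (k : fieldType) (aT : finGroupType) (P : {group aT})
    (Z : finType) (to : {action aT &-> Z}) (F : Z -> k) :
    index_vanishing k P -> (forall h z, h \in P -> F (to z h) = F z) ->
    (forall z, z \in 'Fix_to(P) -> F z = 0%R) ->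
  (\sum_z F z = 0)%R.
Proof.
move=> vanP invF F0.
have actsP: [acts P, on [set: Z] | to].
  by apply/subsetP=> h _; rewrite !inE /=; apply/subsetP=> z; rewrite !inE.
rewrite (eq_bigl [in [set: Z]]) => [|z]; last by rewrite in_setT.
rewrite (set_partition_big _ (orbit_partition actsP)) big1 // => A.
case/imsetP=> z _ ->{A}.
rewrite (eq_bigr (fun=> F z)) => [|y /imsetP[h Ph ->]]; last exact: invF.
rewrite sumr_const card_orbit -mulr_natl.
have [fixz|] := boolP (z \in 'Fix_to(P)); first by rewrite F0 ?mulr0.
(* The orbit length is the index of the stabiliser, which is proper as [z] is not fixed. *)
move=> nfixz; rewrite vanP ?mul0r // properE subsetIl /= subsetI subxx /=.
by rewrite sub_astab1.
Qed.

(** * Equivariant maps and functions vanishing on fixed points *)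

Section Equivariant.
Variables (k : fieldType) (aT : finGroupType) (Z W : finType).
Variables (toZ : {action aT &-> Z}) (toW : {action aT &-> W}).

Definition equivariant (phi : {ffun Z -> k^o} -> {ffun W -> k^o}) : Prop :=
  forall g f, phi (permmod_act toZ g f) = permmod_act toW g (phi f).

Definition delta (z : Z) : {ffun Z -> k^o} := [ffun y => (y == z)%:R%R].

Lemma ffun_delta (f : {ffun Z -> k^o}) : f = (\sum_z f z *: delta z)%R.
Proof.
apply/ffunP=> y; rewrite sum_ffunE (bigD1 y) //= big1 => [|z /negPf nzy].
  by rewrite !ffunE eqxx addr0 /GRing.scale /= mulr1.
by rewrite !ffunE eq_sym nzy scaler0.
Qed.

Lemma permmod_act_delta z g :
  permmod_act toZ g (delta (toZ z g)) = delta z.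
Proof. by apply/ffunP=> y; rewrite !ffunE (inj_eq (act_inj toZ g)). Qed.

(** By linearity, [phi f w] is the sum over [z] of [f z * phi (delta z) w]. Since [w] is fixed, the
    terms are constant on [P]-orbits; they vanish at fixed [z], so [sum_fix_vanish] applies. *)
Lemma equivariant_fix_vanish (P : {group aT})
    (phi : {linear {ffun Z -> k^o} -> {ffun W -> k^o}}%R)
    (f : {ffun Z -> k^o}) (w : W) :
    index_vanishing k P -> equivariant phi ->
    (forall h z, h \in P -> f (toZ z h) = f z) ->
    (forall z, z \in 'Fix_toZ(P) -> f z = 0%R) ->
  w \in 'Fix_toW(P) -> phi f w = 0%R.
Proof.
move=> vanP eqv invf f0 /afixP fixw.
rewrite {1}(ffun_delta f) linear_sum sum_ffunE.
apply: (sum_fix_vanish (to := toZ) vanP) => [h z Ph|z fixz].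
  rewrite invf // !linearZ !ffunE.
  (* [delta z] is the translate by [h] of [delta (toZ z h)]; equivariance moves [h] onto [w]. *)
  by rewrite -[in RHS](permmod_act_delta z h) eqv ffunE fixw.
by rewrite f0 // scale0r linear0 ffunE.
Qed.
End Equivariant.

(** * Functions on the [C]-orbits of [P]-fixed points *)

Definition fix_orbits (aT : finGroupType) (Z : finType)
    (to : {action aT &-> Z}) (P : {set aT}) (C : {group aT}) :=
  [set orbit to C x | x in 'Fix_to(P)].

Section OrbitFunctions.
Variables (k : fieldType) (aT : finGroupType) (Z : finType).
Variables (to : {action aT &-> Z}) (P C : {group aT}).
Hypothesis nPC : C \subset 'N(P).

Let O := {A : {set Z} | A \in fix_orbits to P C}.

(** Extension by zero off the fixed points. The [oapp] default is never reached: the orbit of a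
    fixed point lies in [fix_orbits]. *)
Definition orbit_lift (u : {ffun O -> k^o}) : {ffun Z -> k^o} :=
  [ffun z => if z \in 'Fix_to(P) then
               oapp u 0%R (insub (orbit to C z)) else 0%R].

(** Picking one point per orbit keeps the map linear on all functions; on [C]-invariant ones the
    choice does not matter. *)
Definition orbit_eval (f : {ffun Z -> k^o}) : {ffun O -> k^o} :=
  [ffun A : O => oapp f 0%R [pick z in val A]].

Lemma orbit_lift_linear : linear orbit_lift.
Proof.
move=> a u v; apply/ffunP=> z; rewrite !ffunE.
case: ifP => _; last by rewrite scaler0 addr0.
by case: insub => [A|] /=; rewrite ?ffunE ?scaler0 ?addr0.
Qed.

Lemma orbit_eval_linear : linear orbit_eval.
Proof.
move=> a u v; apply/ffunP=> A; rewrite !ffunE.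
by case: pickP => [z _|_] /=; rewrite ?ffunE ?scaler0 ?addr0.
Qed.

Lemma orbit_lift_invP u h z : h \in P -> orbit_lift u (to z h) = orbit_lift u z.
Proof.
move=> Ph; rewrite !ffunE.
have -> : (to z h \in 'Fix_to(P)) = (z \in 'Fix_to(P)).
  by have /acts_act-> := acts_fix_norm to (normG P).
by case: ifP => // /afixP->.
Qed.

Lemma orbit_lift_invC u h z : h \in C -> orbit_lift u (to z h) = orbit_lift u z.
Proof.
move=> Ch; rewrite !ffunE orbit_act //.
by have /acts_act-> := acts_fix_norm to nPC.
Qed.

Lemma orbit_lift_eq0 u :
  (forall z, z \in 'Fix_to(P) -> orbit_lift u z = 0%R) -> u = 0%R.
Proof.
move=> u0; apply/ffunP=> A; rewrite !ffunE.
have /imsetP[z fixz defA] := valP A.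
by have:= u0 z fixz; rewrite ffunE fixz -defA valK.
Qed.

Lemma orbit_eval_eq0 (f : {ffun Z -> k^o}) z :
    (forall h y, h \in C -> f (to y h) = f y) ->
    orbit_eval f = 0%R -> z \in 'Fix_to(P) -> f z = 0%R.
Proof.
move=> invf f0 fixz; have Oz: orbit to C z \in fix_orbits to P C.
  exact: imset_f.
have /ffunP/(_ (exist _ (orbit to C z) Oz)) := f0; rewrite !ffunE /=.
case: pickP => [y /imsetP[h Ch ->]|/(_ z)]; first by rewrite /= invf.
by rewrite orbit_refl.
Qed.
End OrbitFunctions.

HB.instance Definition _ (k : fieldType) (aT : finGroupType) (Z : finType)
    (to : {action aT &-> Z}) (P C : {group aT}) :=
  GRing.isLinear.Build k _ _ *:%R (@orbit_lift k aT Z to P C)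
    (@orbit_lift_linear k aT Z to P C).
HB.instance Definition _ (k : fieldType) (aT : finGroupType) (Z : finType)
    (to : {action aT &-> Z}) (P C : {group aT}) :=
  GRing.isLinear.Build k _ _ *:%R (@orbit_eval k aT Z to P C)
    (@orbit_eval_linear k aT Z to P C).

(** The cardinals are the dimensions of the two function spaces. *)
Lemma linear_inj_card (k : fieldType) (A B : finType)
    (f : {linear {ffun A -> k^o} -> {ffun B -> k^o}}%R) :
  (forall u, f u = 0%R -> u = 0%R) -> #|A| <= #|B|.
Proof.
move=> f0.
have kerf0: (fullv :&: lker (linfun f) = 0)%VS.
  apply/eqP; rewrite -subv0; apply/subvP=> u.
  by rewrite memv_cap memvf memv_ker lfunE memv0 => /eqP/f0->.
have := limg_dim_eq kerf0; rewrite dimvf.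
have := dimvS (subvf (limg (linfun f))); rewrite dimvf => /[swap] ->.
by rewrite /dim /= !muln1.
Qed.

(** * Comparing orbit and fixed-point counts of isomorphic permutation modules *)

Section FixedPoints.
Variables (k : fieldType) (aT : finGroupType).

Lemma permmod_iso_inverse (Z W : finType)
    (toZ : {action aT &-> Z}) (toW : {action aT &-> W}) :
    permmod_iso k toZ toW ->
  exists (phi : {linear {ffun Z -> k^o} -> {ffun W -> k^o}}%R)
      (psi : {linear {ffun W -> k^o} -> {ffun Z -> k^o}}%R),
    [/\ cancel phi psi, cancel psi phi,
        equivariant toZ toW phi & equivariant toW toZ psi].
Proof.
case=> phi [[psi phiK psiK] eqv].
pose psiL := GRing.isLinear.Build k _ _ *:%R psi (can2_linear phiK psiK).
pose psi' : {linear {ffun W -> k^o} -> {ffun Z -> k^o}}%R :=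
  HB.pack psi psiL.
exists phi, psi'; split=> //.
by move=> g f; apply: (can_inj phiK); rewrite eqv !psiK.
Qed.

(** Lift, apply [phi], evaluate: this linear map [theta] is injective. If [theta u = 0], the
    invariant function [phi (orbit_lift u)] vanishes on the fixed points of [W], so its image under
    [psi], which is [orbit_lift u], vanishes on those of [Z]. *)
Lemma fix_orbits_le (Z W : finType)
    (toZ : {action aT &-> Z}) (toW : {action aT &-> W}) (P C : {group aT})
    (phi : {linear {ffun Z -> k^o} -> {ffun W -> k^o}}%R)
    (psi : {linear {ffun W -> k^o} -> {ffun Z -> k^o}}%R) :
    cancel phi psi -> equivariant toZ toW phi -> equivariant toW toZ psi ->
    index_vanishing k P -> C \subset 'N(P) ->
  #|fix_orbits toZ P C| <= #|fix_orbits toW P C|.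
Proof.
move=> phiK eqv_phi eqv_psi vanP nPC.
rewrite -[X in X <= _]card_sig -[X in _ <= X]card_sig.
pose theta :=
  @orbit_eval k aT W toW P C \o (phi \o @orbit_lift k aT Z toZ P C).
apply: (@linear_inj_card k _ _ theta) => u /= u0.
have inv_phi h (f : {ffun Z -> k^o}) : (forall z, f (toZ z h) = f z) ->
    forall w, phi f (toW w h) = phi f w.
  move=> invf w; have def_f : permmod_act toZ h f = f.
    by apply/ffunP=> z; rewrite ffunE invf.
  by rewrite -{2}def_f eqv_phi ffunE.
apply: orbit_lift_eq0 => z fixz; rewrite -[orbit_lift u]phiK.
apply: (equivariant_fix_vanish vanP eqv_psi _ _ fixz) => [h w Ph|w fixw].
  by apply: inv_phi => y; apply: orbit_lift_invP.
apply: orbit_eval_eq0 u0 fixw => h y Ch.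
by apply: inv_phi => x; apply: orbit_lift_invC.
Qed.

Lemma card_fix_orbits (Z W : finType)
    (toZ : {action aT &-> Z}) (toW : {action aT &-> W}) (P C : {group aT}) :
    permmod_iso k toZ toW -> index_vanishing k P -> C \subset 'N(P) ->
  #|fix_orbits toZ P C| = #|fix_orbits toW P C|.
Proof.
case/permmod_iso_inverse=> phi [psi [phiK psiK eqv_phi eqv_psi]] vanP nPC.
by apply/eqP; rewrite eqn_leq (fix_orbits_le phiK) // (fix_orbits_le psiK).
Qed.

Lemma card_fix_cycle (Z W : finType)
    (toZ : {action aT &-> Z}) (toW : {action aT &-> W}) (P : {group aT}) g :
    permmod_iso k toZ toW -> index_vanishing k P -> g \in 'N(P) ->
  #|'Fix_('Fix_toZ(P) | toZ)[g]| = #|'Fix_('Fix_toW(P) | toW)[g]|.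
Proof.
move=> iso vanP; have [m] := ubnP #[g]; elim: m g => // m IHm g le_gm nPg.
have nPC : <[g]> \subset 'N(P) by rewrite cycle_subG.
(* Orbit count times group order is the Cauchy-Frobenius sum of fixed-point counts over [<[g]>]. *)
have := congr1 (muln^~ #[g]) (card_fix_orbits iso vanP nPC).
have FCZ := Frobenius_Cauchy (acts_fix_norm toZ nPC).
have FCW := Frobenius_Cauchy (acts_fix_norm toW nPC).
rewrite -FCZ -FCW /= (bigID (generator <[g]>)) [in RHS](bigID (generator <[g]>)) /=.
set sZ := (X in _ + X = _); set sW := (X in _ = _ + X).
(* Non-generators have smaller order, so induction matches their terms. *)
have -> : sZ = sW.
  apply: eq_bigr => a /andP[ga ngen]; apply: IHm; last exact: (subsetP nPC).
  apply: (@leq_trans #[g]); last by rewrite -ltnS.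
  apply: proper_card.
  by rewrite properEneq cycle_subG ga andbT eq_sym.
(* All generators have the fixed points of [g]; their number is positive and cancels. *)
have fix_gen (V : finType) (to : {action aT &-> V}) :
    \sum_(a in <[g]> | generator <[g]> a) #|'Fix_('Fix_to(P) | to)[a]|
      = (#|[pred a in <[g]> | generator <[g]> a]| * #|'Fix_('Fix_to(P) | to)[g]|)%N.
  rewrite -sum_nat_const; apply: eq_bigr => a /andP[_ /eqP gen_a].
  by rewrite -!(afix_cycle to) gen_a.
rewrite !fix_gen => /addIn/eqP; rewrite eqn_pmul2l => [/eqP//|].
by apply/card_gt0P; exists g; rewrite inE cycle_id generator_cycle.
Qed.
End FixedPoints.

(** * Similarity, action homomorphisms and fixed cosets *)

Lemma similar_gsets_card_fix (aT1 aT2 : finGroupType) (H1 : {group aT1})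
    (H2 : {group aT2}) (Z W : finType)
    (toZ : action H1 Z) (toW : action H2 W) :
  similar_gsets toZ toW -> #|'Fix_toZ(H1)| = #|'Fix_toW(H2)|.
Proof.
case=> mu [psi [[nu muK nuK] /isomP[_ im_psi] eqv]].
rewrite -(card_imset _ (can_inj muK)).
suff -> : mu @: 'Fix_toZ(H1) = 'Fix_toW(H2) by [].
apply/setP=> w; apply/imsetP/afixP => [[z /afixP fixz ->] h' | fixw].
  by rewrite -{1}im_psi => /morphimP[h _ Hh ->]; rewrite -eqv // fixz.
exists (nu w); rewrite ?nuK //; apply/afixP=> h Hh; apply: (can_inj muK).
by rewrite eqv // nuK fixw // -im_psi mem_morphim.
Qed.

Section ActionHom.
Variables (gT : finGroupType) (X : finType) (to : {action gT &-> X}) (n : nat).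
Variables (e : X -> 'I_n) (e' : 'I_n -> X).
Hypotheses (eK : cancel e e') (e'K : cancel e' e).

Lemma action_homE g x : action_hom to eK e'K g (e x) = e (to x g).
Proof. by rewrite permE eK. Qed.

Lemma injm_action_hom :
    [faithful [set: gT], on [set: X] | to] ->
  'injm (action_hom_morphism to eK e'K).
Proof.
move/faithfulP=> faithX; apply/subsetP=> g /morphpreP[_ /set1P /= g1].
apply/set1P/faithX; rewrite ?inE // => x _ /=.
by apply: (can_inj eK); rewrite -action_homE g1 perm1.
Qed.
End ActionHom.

Lemma coset_action_fixP (gT : finGroupType) (G : {group gT}) (A : {set gT})
    (B : coset_space G) :
  reflect (forall g, g \in A -> val B :* g = val B)
          (B \in 'Fix_(coset_action G)(A)).
Proof.
apply: (iffP afixP) => fixB g Ag; first by rewrite -val_coset_action fixB.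
by apply: val_inj; rewrite val_coset_action fixB.
Qed.

(** [A] fixes the coset [G :* s] exactly when [A :^ s^-1] lies in [G]. *)
Lemma coset_action_fix_exists (gT : finGroupType) (G A : {group gT}) :
  (exists B, B \in 'Fix_(coset_action G)(A)) <-> exists s, A :^ s \subset G.
Proof.
split=> [[B /coset_action_fixP fixB] | [s sAsG]].
  have /rcosetsP[s _ defB] := valP B.
  exists s^-1; apply/subsetP=> _ /imsetP[g Ag ->].
  have: s * g \in G :* s.
    by rewrite -defB -(fixB g Ag) defB mem_rcoset mulgK rcoset_refl.
  by rewrite mem_rcoset conjgE invgK mulgA.
have Gs : G :* s^-1 \in rcosets G [set: gT].
  by apply/rcosetsP; exists s^-1; rewrite ?inE.
exists (exist _ (G :* s^-1) Gs); apply/coset_action_fixP=> g Ag /=.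
rewrite -rcosetM; apply/rcoset_eqP; rewrite mem_rcoset invgK -mulgA -conjgE.
by apply: (subsetP sAsG); rewrite memJ_conjg.
Qed.

(** * From a conjugating permutation to a similarity *)

Theorem lemma4p2 (p : nat) (k : fieldType) (chark : has_char k p)
    (gT : finGroupType) (X Y : finType)
    (toX : {action gT &-> X}) (toY : {action gT &-> Y})
    (faithX : [faithful [set: gT], on [set: X] | toX])
    (faithY : [faithful [set: gT], on [set: Y] | toY])
    (n : nat) (cardX : #|X| = n) (cardY : #|Y| = n)
    (eX : X -> 'I_n) (eX' : 'I_n -> X)
    (eXK : cancel eX eX') (eX'K : cancel eX' eX)
    (eY : Y -> 'I_n) (eY' : 'I_n -> Y)
    (eYK : cancel eY eY') (eY'K : cancel eY' eY)
    (isoXY : permmod_iso k (coset_action (action_image toX eXK eX'K))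
                           (coset_action (action_image toY eYK eY'K)))
    (H1 : {group gT}) (cycH1 : cyclic_mod p H1) :
  exists H2 : {group gT},
    similar_gsets (toX \ subsetT H1)%act (toY \ subsetT H2)%act /\
    #|('Fix_toX(H1))%g| = #|('Fix_toY(H2))%g|.
Proof.
set fX := action_hom_morphism toX eXK eX'K.
set fY := action_hom_morphism toY eYK eY'K.
have injX : 'injm fX := injm_action_hom eXK eX'K faithX.
have injY : 'injm fY := injm_action_hom eYK eY'K faithY.
have [P [g [pP nPg defH1]]] := cyclic_mod_gen cycH1.
have fixE (V : finType) (to : {action 'S_n &-> V}) :
    'Fix_to(fX @* H1) = 'Fix_('Fix_to(fX @* P) | to)[fX g].
  rewrite defH1 morphimMl ?subsetT // morphim_cycle ?inE //.
  apply/setP=> v; rewrite -afix_cycle [RHS]inE.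
  apply/afixP/andP=> [fixv | [/afixP fixP /afixP fixg] _ /mulsgP[a b Pa gb ->]].
    split; apply/afixP=> a Aa; apply: fixv; apply: (subsetP _ _ Aa).
      exact: mulG_subl.
    exact: mulG_subr.
  by rewrite actM fixP ?fixg.
have vanP : index_vanishing k (fX @* P).
  by apply: (pgroup_index_vanishing chark); apply: morphim_pgroup.
have nfPg : fX g \in 'N(fX @* P).
  by rewrite -cycle_subG -morphim_cycle ?inE // morphim_norms ?cycle_subG.
(* The trivial coset is fixed on the [X] side, so the equal count on the [Y] side is positive. *)
have [B fixB] : exists B,
    B \in 'Fix_(coset_action (action_image toY eYK eY'K))(fX @* H1).
  apply/card_gt0P; rewrite fixE -(card_fix_cycle isoXY vanP nfPg) -fixE.
  apply/card_gt0P; apply/coset_action_fix_exists; exists 1.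
  by rewrite conjsg1 morphimS ?subsetT.
have [s sH1Y] : exists s, fX @* H1 :^ s \subset fY @* [set: gT].
  by apply/coset_action_fix_exists; exists B.
(* Conjugation by [s] lands in the image of [fY], where faithfulness of [Y] allows pulling back to
   [gT]. *)
pose psi0 h := invm injY (fX h ^ s).
have sY h : h \in H1 -> fX h ^ s \in fY @* [set: gT].
  by move=> Hh; apply: (subsetP sH1Y); rewrite memJ_conjg mem_morphim ?inE.
have psiM : {in H1 &, {morph psi0 : g h / g * h}}.
  move=> a b Ha Hb; rewrite /psi0 morphM ?inE // conjMg morphM //; exact: sY.
pose psi := Morphism psiM.
have fpsi h : h \in H1 -> fY (psi h) = fX h ^ s.
  by move=> Hh; rewrite /= /psi0 invmK ?sY.
exists (psi @* H1)%G.
suff sim : similar_gsets (toX \ subsetT H1)%act (toY \ subsetT (psi @* H1))%act.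
  split=> //; have := similar_gsets_card_fix sim.
  by congr (#|pred_of_set _| = #|pred_of_set _|).
(* Read through the labellings, [mu] is the permutation [s] itself; [fpsi] is its equivariance. *)
exists (fun x => eY' (s (eX x))), psi; split.
- exists (fun y => eX' (s^-1 (eY y))) => x; first by rewrite eY'K permK eXK.
  by rewrite eX'K permKV eYK.
- apply/isomP; split=> //; apply/injmP=> a b Ha Hb eq_ab.
  apply: (injmP injX); rewrite ?inE //; apply: (conjg_inj s).
  by rewrite -!fpsi // eq_ab.
move=> h Hh x /=; apply: (can_inj eYK); rewrite eY'K /=.
rewrite -[in RHS](action_homE _ eYK eY'K) eY'K -(action_homE _ eXK eX'K).
have := fpsi h Hh; rewrite /= => ->.
by rewrite conjgE !permM permK.
Qed.
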